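(* Consider the linear model $y=X\beta^*+\varepsilon$ with deterministic design $X\in\mathbb{R}^{N\times n}$, Gaussian noise $\varepsilon\sim N(0,\sigma_\varepsilon^2I_N)$, and $\beta^*\in\mathcal{S}(k,s_1,s_2)$. Let $\hat\beta$ be the $k$-th order Graph-Piecewise-Polynomial-Lasso, $\widehat\Theta$ the CLIME matrix with tuning parameter $\mu>0$, and $\tilde\beta$ the one-step estimator. Then $\sqrt N(\tilde\beta-\beta^* )=\Psi-e$, where $$\Psi=\frac1{\sqrt N}\widehat\Theta X^T\varepsilon\sim N\left(0,\sigma_\varepsilon^2\widehat\Theta\Sigma_N(\widehat\Theta)^T\right),\qquad e=\sqrt N(\widehat\Theta\Sigma_N-I_n)(\hat\beta-\beta^* ).$$ Furthermore, $\|e\|_\infty\le\sqrt N\,\mu\,\|\hat\beta-\beta^*\|_1$.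
   Context: Graph: $\mathcal{G}=(\mathcal{V},\mathcal{E})$ is a known undirected graph with $n$ nodes labelled $1,\dots,n$ and $p$ edges. Its oriented incidence matrix $F\in\{-1,0,1\}^{p\times n}$ has, for the row corresponding to the edge $(i,j)$ with $i<j$, entry $-1$ in position $i$, $+1$ in position $j$, and $0$ elsewhere. The Laplacian is $L=F^TF$. Graph difference operators: $\Delta^{(1)}=F$, and for $k\ge1$, $\Delta^{(k+1)}=F^T\Delta^{(k)}=L^{(k+1)/2}$ if $k$ is odd, $\Delta^{(k+1)}=F\Delta^{(k)}=FL^{k/2}$ if $k$ is even. $k\ge0$ is a fixed integer. Parameter space: $\mathcal{S}(k,s_1,s_2)=\{\beta\in\mathbb{R}^n:\|\Delta^{(k+1)}\beta\|_0\le s_1,\ \|\beta\|_0\le s_2\}$, where $s_1,s_2>0$ and $\|\cdot\|_0$ counts nonzero entries. Estimators: for tuning parameters $\lambda>0,\lambda_g>0$, the $k$-th order Graph-Piecewise-Polynomial-Lasso is $$\hat\beta\in\arg\min_{\beta\in\mathbb{R}^n}\ \frac1{2N}\|y-X\beta\|_2^2+\lambda_g\|\Delta^{(k+1)}\beta\|_1+\lambda\|\beta\|_1 .$$ Let $\Sigma_N=\frac1NX^TX$. The CLIME matrix $\widehat\Theta\in\mathbb{R}^{n\times n}$ is a solution of: minimize $\|\Theta\|_{1,1}=\sum_{i,j}|\Theta_{ij}|$ over $\Theta\in\mathbb{R}^{n\times n}$ subject to $\|\Theta\Sigma_N-I_n\|_\infty\le\mu$ (so $\mu$ is such that the problem is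 feasible). The one-step estimator is $\tilde\beta=\hat\beta+\frac1N\widehat\Theta X^T(y-X\hat\beta)$. $\|\cdot\|_\infty$ is the entrywise maximum absolute value for vectors and matrices. Gaussian distributions may have singular covariance. *)

(* Defs.v *)
From mathcomp Require Import all_boot all_order all_algebra.
From mathcomp Require Import all_classical all_reals all_analysis.

Set Implicit Arguments.
Unset Strict Implicit.
Unset Printing Implicit Defensive.
Import Order.TTheory GRing.Theory Num.Theory.
Import numFieldNormedType.Exports.
Local Open Scope classical_set_scope.
Local Open Scope ring_scope.

(* The entrywise maximum norm of a vector or a matrix is the library norm `|_|
   on matrices (see mx_normrE). *)

Definition norm0 (R : realType) (m : nat) (v : 'cV[R]_m) : nat :=
  #|[set i | v i 0 != 0]%SET|.

Definition norm1 (R : realType) (m : nat) (v : 'cV[R]_m) : R :=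
  \sum_i `|v i 0|.

Definition norm2 (R : realType) (m : nat) (v : 'cV[R]_m) : R :=
  Num.sqrt (\sum_i v i 0 ^+ 2).

Definition norm11 (R : realType) (m n : nat) (A : 'M[R]_(m, n)) : R :=
  \sum_i \sum_j `|A i j|.

Definition is_argmin (R : realType) (V : Type) (C : set V) (f : V -> R)
    (x : V) : Prop :=
  C x /\ forall z, C z -> f x <= f z.

(* Each edge {i, j} of the symmetric relation e is listed once, as the pair
   (i, j) with i < j. *)
Definition edges (n : nat) (e : rel 'I_n) : {set 'I_n * 'I_n} :=
  [set ij : 'I_n * 'I_n | (ij.1 < ij.2)%N && e ij.1 ij.2]%SET.

(* Rows are indexed by the edges in their canonical enumeration; reordering
   them changes neither norm0 nor norm1 of the vectors graph_diff e k *m b. *)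
Definition incidence (R : realType) (n : nat) (e : rel 'I_n) :
    'M[R]_(#|edges e|, n) :=
  \matrix_(r, c)
    let: (i, j) := enum_val r in
    if c == i then -1 else if c == j then 1 else 0.

Definition diff_rows (n : nat) (e : rel 'I_n) (b : bool) : nat :=
  if b then n else #|edges e|.

(* One step of the recursion: from Delta^(k+1) to Delta^(k+2), b = odd k. *)
Definition diff_step (R : realType) (n : nat) (e : rel 'I_n) (b : bool) :
    'M[R]_(diff_rows e b, n) -> 'M[R]_(diff_rows e (~~ b), n) :=
  if b return 'M[R]_(diff_rows e b, n) -> 'M[R]_(diff_rows e (~~ b), n)
  then fun D => incidence R e *m D
  else fun D => (incidence R e)^T *m D.

(* graph_diff R e k is the operator Delta^(k+1), with the index shifted by one:
   F for k = 0, F^T F for k = 1, F F^T F for k = 2, ... *)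
Fixpoint graph_diff (R : realType) (n : nat) (e : rel 'I_n) (k : nat) :
    'M[R]_(diff_rows e (odd k), n) :=
  match k with
  | 0 => incidence R e
  | k'.+1 => diff_step (graph_diff R e k')
  end.

Definition param_space (R : realType) (n : nat) (e : rel 'I_n) (k : nat)
    (s1 s2 : R) : set 'cV[R]_n :=
  [set b | (norm0 (graph_diff R e k *m b))%:R <= s1 /\ (norm0 b)%:R <= s2].

Definition gpp_lasso_obj (R : realType) (n N : nat) (e : rel 'I_n) (k : nat)
    (lam_g lam : R) (X : 'M[R]_(N, n)) (y : 'cV[R]_N) (b : 'cV[R]_n) : R :=
  (2 * N%:R)^-1 * norm2 (y - X *m b) ^+ 2
  + lam_g * norm1 (graph_diff R e k *m b) + lam * norm1 b.

Definition is_gpp_lasso (R : realType) (n N : nat) (e : rel 'I_n) (k : nat)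
    (lam_g lam : R) (X : 'M[R]_(N, n)) (y : 'cV[R]_N) (b : 'cV[R]_n) : Prop :=
  is_argmin setT (gpp_lasso_obj e k lam_g lam X y) b.

Definition sample_cov (R : realType) (n N : nat) (X : 'M[R]_(N, n)) :
    'M[R]_n :=
  N%:R^-1 *: (X^T *m X).

Definition is_clime (R : realType) (n N : nat) (mu : R) (X : 'M[R]_(N, n))
    (Theta : 'M[R]_n) : Prop :=
  is_argmin [set A : 'M[R]_n | `|A *m sample_cov X - 1%:M| <= mu]
    (@norm11 R n n) Theta.

Definition one_step (R : realType) (n N : nat) (X : 'M[R]_(N, n))
    (Theta : 'M[R]_n) (y : 'cV[R]_N) (b : 'cV[R]_n) : 'cV[R]_n :=
  b + N%:R^-1 *: (Theta *m X^T *m (y - X *m b)).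

(* Univariate N(m, v) with variance v >= 0, a point mass when v = 0 (the
   library's normal_prob takes the standard deviation, and is not a point mass
   at standard deviation 0). *)
Definition gauss1 (R : realType) (m v : R) (A : set R) : \bar R :=
  if v == 0 then \d_m A else normal_prob m (Num.sqrt v) A.

(* Z ~ N(m, S) on R^d, with S symmetric positive semidefinite and possibly
   singular: Z is a random vector all of whose linear combinations u^T Z have
   law N(u^T m, u^T S u). *)
Definition gaussian_vector (R : realType) (disp : measure_display)
    (T : measurableType disp) (P : probability T R) (d : nat)
    (Z : T -> 'cV[R]_d) (m : 'cV[R]_d) (S : 'M[R]_d) : Prop :=
  [/\ S^T = S,
      forall u : 'cV[R]_d, 0 <= (u^T *m S *m u) 0 0,
      forall i, measurable_fun setT (fun w => Z w i 0)
    & forall (u : 'cV[R]_d) (A : set R), measurable A ->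
        P ((fun w => (u^T *m Z w) 0 0) @^-1` A)
        = gauss1 ((u^T *m m) 0 0) ((u^T *m S *m u) 0 0) A].

(* Main.v *)
Require Import Defs.
From mathcomp Require Import all_boot all_order all_algebra.
From mathcomp Require Import all_classical all_reals all_analysis.

Set Implicit Arguments.
Unset Strict Implicit.
Unset Printing Implicit Defensive.
Import Order.TTheory GRing.Theory Num.Theory.
Import numFieldNormedType.Exports.
Local Open Scope classical_set_scope.
Local Open Scope ring_scope.

(** The decomposition is exact algebra.  With y = X beta^* + eps, the correction
    step of the one-step estimator leaves (I - Theta Sigma) times the initial
    error beta_hat - beta^*, which becomes the term - e after scaling by sqrt N,
    and adds the noise Theta X^T eps / N, which becomes Psi
    (one_step_decomposition).

    Psi is a fixed linear image of the Gaussian noise, and Gaussian vectors are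
    stable under linear maps: with Gaussianity described through the laws of
    the linear functionals u^T Z, a functional u^T A Z of A Z is the functional
    (A^T u)^T Z of Z (gaussian_vector_mulmx).  Taking A = Theta X^T / sqrt N,
    the covariance sigma^2 A A^T is sigma^2 Theta Sigma Theta^T.

    The bias bound is the duality of the entrywise maximum norm and the l1 norm
    (mx_norm_mulmx), combined with the feasibility of the CLIME matrix,
    |Theta Sigma - I| <= mu. *)

Lemma mx_norm_entry (R : realType) (m n : nat) (A : 'M[R]_(m, n)) i j :
  `|A i j| <= `|A|.
Proof.
rewrite [leRHS]mx_normrE.
exact: (le_bigmax _ (fun ij : 'I_m * 'I_n => `|A ij.1 ij.2|) (i, j)).
Qed.

Lemma mx_norm_le (R : realType) (m n : nat) (A : 'M[R]_(m, n)) (c : R) :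
  0 <= c -> (forall i j, `|A i j| <= c) -> `|A| <= c.
Proof.
by move=> c_ge0 Ac; rewrite [leLHS]mx_normrE; apply: bigmax_le => // -[i j] _.
Qed.

Lemma norm1_ge0 (R : realType) (n : nat) (v : 'cV[R]_n) : 0 <= norm1 v.
Proof. by apply: sumr_ge0. Qed.

(** Hoelder's inequality for the exponents oo and 1, applied to each row. *)
Lemma mx_norm_mulmx (R : realType) (m n : nat) (A : 'M[R]_(m, n))
    (v : 'cV[R]_n) : `|A *m v| <= `|A| * norm1 v.
Proof.
apply: mx_norm_le => [|i j]; first by rewrite mulr_ge0 ?norm1_ge0.
rewrite mxE (le_trans (ler_norm_sum _ _ _))// /norm1 mulr_sumr ler_sum// => l _.
by rewrite normrM (ord1 j) ler_wpM2r// mx_norm_entry.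
Qed.

(** A linear functional of A Z is a linear functional of Z, with coefficient
    vector A^T u; its mean and variance are those that A m and A S A^T give. *)
Lemma gaussian_vector_mulmx (R : realType) (disp : measure_display)
    (T : measurableType disp) (P : probability T R) (d p : nat)
    (Z : T -> 'cV[R]_d) (m : 'cV[R]_d) (S : 'M[R]_d) (A : 'M[R]_(p, d)) :
  gaussian_vector P Z m S ->
  gaussian_vector P (fun w => A *m Z w) (A *m m) (A *m S *m A^T).
Proof.
case=> S_sym S_psd Z_meas Z_law.
have quadE (u : 'cV[R]_p) :
    u^T *m (A *m S *m A^T) *m u = (A^T *m u)^T *m S *m (A^T *m u).
  by rewrite trmx_mul trmxK !mulmxA.
have linE (u : 'cV[R]_p) (z : 'cV[R]_d) :
    u^T *m (A *m z) = (A^T *m u)^T *m z.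
  by rewrite trmx_mul trmxK mulmxA.
split=> [|u|i|u B mB].
- by rewrite !trmx_mul trmxK S_sym mulmxA.
- by rewrite quadE.
- under eq_fun do rewrite mxE.
  by apply: measurable_sum => j; apply: measurableT_comp.
- rewrite linE quadE -Z_law//; congr (P _).
  by apply/seteqP; split=> w /=; rewrite linE.
Qed.

(** The residual is z - X (b - b0), so the correction step adds the noise term
    and subtracts Theta Sigma (b - b0), leaving (I - Theta Sigma) (b - b0) of
    the initial error b - b0. *)
Lemma one_step_decomposition (R : realType) (n N : nat) (N_gt0 : (0 < N)%N)
    (X : 'M[R]_(N, n)) (Theta : 'M[R]_n) (b b0 : 'cV[R]_n) (z : 'cV[R]_N) :
  Num.sqrt N%:R *: (one_step X Theta (X *m b0 + z) b - b0) =
  (Num.sqrt N%:R)^-1 *: (Theta *m X^T *m z)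
  - Num.sqrt N%:R *: ((Theta *m sample_cov X - 1%:M) *m (b - b0)).
Proof.
have s_neq0 : Num.sqrt N%:R != 0 :> R by rewrite sqrtr_eq0 -ltNge ltr0n.
have -> : (Num.sqrt N%:R)^-1 = Num.sqrt N%:R * N%:R^-1 :> R.
  by rewrite -[in N%:R^-1](@sqr_sqrtr R N%:R)// expr2 invfM mulVKf.
rewrite -scalerA -scalerBr; congr (_ *: _).
rewrite /one_step /sample_cov -scalemxAr mulmxBl mul1mx -scalemxAl.
have -> : X *m b0 + z - X *m b = z - X *m (b - b0).
  by rewrite mulmxBr opprB addrAC addrC.
rewrite mulmxBr !mulmxA scalerBr opprB.
by rewrite addrCA -addrA [b - _ - b0]addrAC.
Qed.

Theorem theorem5 (R : realType) (disp : measure_display)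
    (T : measurableType disp) (P : probability T R)
    (n : nat) (e : rel 'I_n) (e_sym : symmetric e) (e_irr : irreflexive e)
    (k : nat) (N : nat) (N_gt0 : (0 < N)%N)
    (X : 'M[R]_(N, n)) (beta_star : 'cV[R]_n)
    (s1 s2 : R) (s1_gt0 : 0 < s1) (s2_gt0 : 0 < s2)
    (beta_star_in : param_space e k s1 s2 beta_star)
    (sigma_eps : R) (sigma_eps_ge0 : 0 <= sigma_eps)
    (eps : T -> 'cV[R]_N)
    (eps_gauss : gaussian_vector P eps 0 (sigma_eps ^+ 2 *: 1%:M))
    (y : T -> 'cV[R]_N) (y_model : forall w, y w = X *m beta_star + eps w)
    (lam_g lam : R) (lam_g_gt0 : 0 < lam_g) (lam_gt0 : 0 < lam)
    (beta_hat : T -> 'cV[R]_n)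
    (beta_hat_lasso : forall w, is_gpp_lasso e k lam_g lam X (y w) (beta_hat w))
    (mu : R) (mu_gt0 : 0 < mu)
    (Theta : 'M[R]_n) (Theta_clime : is_clime mu X Theta) :
  let Sigma := sample_cov X in
  let beta_tilde w := one_step X Theta (y w) (beta_hat w) in
  let Psi w := (Num.sqrt N%:R)^-1 *: (Theta *m X^T *m eps w) in
  let err w :=
    Num.sqrt N%:R *: ((Theta *m Sigma - 1%:M) *m (beta_hat w - beta_star)) in
  [/\ forall w, Num.sqrt N%:R *: (beta_tilde w - beta_star) = Psi w - err w,
      gaussian_vector P Psi 0 (sigma_eps ^+ 2 *: (Theta *m Sigma *m Theta^T))
    & forall w,
        `|err w| <= Num.sqrt N%:R * mu * norm1 (beta_hat w - beta_star)].
Proof.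
move=> Sigma beta_tilde Psi err; split.
- by move=> w; rewrite /beta_tilde /Psi /err y_model one_step_decomposition.
- pose A := (Num.sqrt N%:R)^-1 *: (Theta *m X^T).
  have := gaussian_vector_mulmx A eps_gauss.
  have -> : (fun w => A *m eps w) = Psi.
    by apply/funext => w; rewrite /Psi /A -scalemxAl.
  rewrite mulmx0.
  suff -> : A *m (sigma_eps ^+ 2 *: 1%:M) *m A^T =
      sigma_eps ^+ 2 *: (Theta *m Sigma *m Theta^T) by [].
  rewrite -scalemxAr mulmx1 -scalemxAl; congr (_ *: _).
  rewrite /A /Sigma /sample_cov linearZ/= -scalemxAr -!scalemxAl scalerA.
  by rewrite -scalemxAr -scalemxAl -invfM -expr2 sqr_sqrtr// trmx_mul trmxK
     !mulmxA.
- move=> w; case: Theta_clime => Theta_feasible _.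
  rewrite /err normrZ ger0_norm ?sqrtr_ge0// -mulrA ler_wpM2l ?sqrtr_ge0//.
  by rewrite (le_trans (mx_norm_mulmx _ _))// ler_wpM2r ?norm1_ge0.
Qed.
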